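(* Let $u\in\mathcal U$ be the input applied at time $T$ and $y=x_{T+1}$ the resulting next state, and let $\mathcal C_{T+1}$ be formed from the data over $[0,T]$ extended by $(u,y)$. Then, with $h_T(u,y)$ and $R_T$ as defined in the context, for any $(\vartheta,\alpha,\rho)\in\mathcal K$, $$\mathcal C_{T+1}(\vartheta,\alpha,\rho)=\mathcal C_T(\vartheta,\alpha,\rho)+\alpha\,h_T(u,y)h_T(u,y)^\top-\alpha R_T .$$
   Context: Let $p=n+m$. Measurements come from an unknown controllable system $x_{t+1}=A_\star x_t+B_\star u_t+e_t$, $x_t\in\mathbb R^n$, $u_t\in\mathbb R^m$, $e_t\in\mathbb R^n$ unmeasured. Put $X_T=[x_0\ \cdots\ x_{T-1}]$, $U_T=[u_0\ \cdots\ u_{T-1}]$, $Y_T=[x_1\ \cdots\ x_T]$, $E_T=[e_0\ \cdots\ e_{T-1}]$, $W_T=\begin{bmatrix}X_T\\ U_T\end{bmatrix}\in\mathbb R^{p\times T}$. Standing assumptions ($\preceq$ is the Loewner order): $W_T$ has full row rank $p$; there are known symmetric $\Delta_t\in\mathbb R^{n\times n}$ with $E_TE_T^\top\preceq\Delta_T$ for every $T$; with $\Omega_T:=\Delta_{T+1}-\Delta_T$, the disturbance at time $T$ satisfies $e_Te_T^\top\preceq\Omega_T$; the set $\mathcal U\subset\mathbb R^m$ of admissible inputs is compact. Let $$N_T=\begin{bmatrix}\Delta_T&0\\ 0&0_p\end{bmatrix}-\begin{bmatrix}Y_T\\ -W_T\end{bmatrix}\begin{bmatrix}Y_T\\ -W_T\end{bmatrix}^\top\in\mathbb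 R^{(n+p)\times(n+p)},\qquad \mathcal C_T(\vartheta,\alpha,\rho)=\mathcal F(\vartheta,\rho)-\alpha\,ON_TO^\top,$$ where $\mathcal F$ is a data-independent symmetric-matrix-valued map, affine in the decision variables $\vartheta$ and in $\rho\in\mathbb R$; $O$ is a constant matrix with $n+p$ columns; $\alpha\ge0$ is a scalar; $\mathcal K$ is a data-independent constraint set for $(\vartheta,\alpha,\rho)$. $\mathcal C_{T+1}$ is defined in the same way (same $\mathcal F$, $O$) from the data matrices $W_{T+1}=[W_T\ \ w_T(u)]$, $Y_{T+1}=[Y_T\ \ y]$ and $\Delta_{T+1}=\Delta_T+\Omega_T$. For $u\in\mathcal U$, $y\in\mathbb R^n$: $w_T(u)=\begin{bmatrix}x_T\\ u\end{bmatrix}$, $q_T(u,y)=\begin{bmatrix}y\\ -w_T(u)\end{bmatrix}\in\mathbb R^{n+p}$, $R_T^N=\begin{bmatrix}\Omega_T&0\\ 0&0_p\end{bmatrix}$, $h_T(u,y)=O\,q_T(u,y)$, $R_T=O R_T^NO^\top$. *)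

(* Defs.v *)
From HB Require Import structures.
From mathcomp Require Import all_boot all_order all_algebra.
From mathcomp Require Import all_classical all_reals all_analysis.
Set Implicit Arguments.
Unset Strict Implicit.
Unset Printing Implicit Defensive.
Import Order.TTheory GRing.Theory Num.Theory.
Import numFieldNormedType.Exports.
Local Open Scope ring_scope.

(* Positive semidefiniteness includes symmetry. *)
Definition psdmx (R : realType) (n : nat) (M : 'M[R]_n) : Prop :=
  M^T = M /\ forall v : 'cV[R]_n, 0 <= (v^T *m M *m v) ord0 ord0.

Definition loewner_le (R : realType) (n : nat) (A B : 'M[R]_n) : Prop :=
  psdmx (B - A).

Definition is_affine (R : realType) (V W : lmodType R) (f : V -> W) : Prop :=
  forall (s : R) (a b : V),
    f (s *: a + (1 - s) *: b) = s *: f a + (1 - s) *: f b.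

Definition trajectory (R : realType) (n m : nat) (A : 'M[R]_n) (B : 'M[R]_(n, m))
    (x : nat -> 'cV[R]_n) (u : nat -> 'cV[R]_m) (e : nat -> 'cV[R]_n) : Prop :=
  forall t : nat, x t.+1 = A *m x t + B *m u t + e t.

(* Every state can be steered to every other one in finite time by the
   disturbance-free system. *)
Definition controllable (R : realType) (n m : nat)
    (A : 'M[R]_n) (B : 'M[R]_(n, m)) : Prop :=
  forall a b : 'cV[R]_n,
    exists (z : nat -> 'cV[R]_n) (v : nat -> 'cV[R]_m) (k : nat),
      [/\ trajectory A B z v (fun=> 0), z 0%N = a & z k = b].

(* The matrix [z_0 ... z_(T-1)]. *)
Definition datamx (R : realType) (k : nat) (z : nat -> 'cV[R]_k) (T : nat) :
  'M[R]_(k, T) := \matrix_(i < k, t < T) z t i ord0.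

Definition Ymx (R : realType) (n : nat) (x : nat -> 'cV[R]_n) (T : nat) :
  'M[R]_(n, T) := datamx (fun t => x t.+1) T.

Definition Wmx (R : realType) (n m : nat)
    (x : nat -> 'cV[R]_n) (u : nat -> 'cV[R]_m) (T : nat) : 'M[R]_(n + m, T) :=
  col_mx (datamx x T) (datamx u T).

Definition Omega (R : realType) (n : nat) (Delta : nat -> 'M[R]_n) (T : nat) :
  'M[R]_n := Delta T.+1 - Delta T.

(* N and C take the data matrices themselves, with any number T of columns, so
   that they apply both to (Y_T, W_T) and to the extension ([Y_T y], [W_T w]). *)
Definition Nmx (R : realType) (n p T : nat)
    (D : 'M[R]_n) (Y : 'M[R]_(n, T)) (W : 'M[R]_(p, T)) : 'M[R]_(n + p) :=
  block_mx D 0 0 0 - col_mx Y (- W) *m (col_mx Y (- W))^T.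

Definition Cmx (R : realType) (V : Type) (k n p T : nat)
    (F : V -> R -> 'M[R]_k) (O : 'M[R]_(k, n + p))
    (D : 'M[R]_n) (Y : 'M[R]_(n, T)) (W : 'M[R]_(p, T))
    (theta : V) (alpha rho : R) : 'M[R]_k :=
  F theta rho - alpha *: (O *m Nmx D Y W *m O^T).

Definition wvec (R : realType) (n m : nat) (xT : 'cV[R]_n) (u : 'cV[R]_m) :
  'cV[R]_(n + m) := col_mx xT u.

Definition qvec (R : realType) (n m : nat)
    (xT : 'cV[R]_n) (u : 'cV[R]_m) (y : 'cV[R]_n) : 'cV[R]_(n + (n + m)) :=
  col_mx y (- wvec xT u).

Definition hvec (R : realType) (k n m : nat) (O : 'M[R]_(k, n + (n + m)))
    (xT : 'cV[R]_n) (u : 'cV[R]_m) (y : 'cV[R]_n) : 'cV[R]_k :=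
  O *m qvec xT u y.

Definition RNmx (R : realType) (n p : nat) (Om : 'M[R]_n) : 'M[R]_(n + p) :=
  block_mx Om 0 0 0.

Definition Rmx (R : realType) (k n p : nat) (O : 'M[R]_(k, n + p))
    (Om : 'M[R]_n) : 'M[R]_k :=
  O *m RNmx p Om *m O^T.

(* Appending the time-T input and the resulting state to the data matrices
   gives the data matrices of horizon T + 1. *)
Lemma datamx_add1 (R : realType) (k : nat) (z : nat -> 'cV[R]_k) (T : nat) :
  datamx z (T + 1) = row_mx (datamx z T) (z T).
Proof.
apply/matrixP => i j; rewrite !mxE; case: splitP => l jE; rewrite ?mxE jE //.
by rewrite ord1 addn0.
Qed.

Lemma Ymx_add1 (R : realType) (n : nat) (x : nat -> 'cV[R]_n) (T : nat) :
  Ymx x (T + 1) = row_mx (Ymx x T) (x T.+1).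
Proof. exact: datamx_add1. Qed.

Lemma Wmx_add1 (R : realType) (n m : nat)
    (x : nat -> 'cV[R]_n) (u : nat -> 'cV[R]_m) (T : nat) :
  Wmx x u (T + 1) = row_mx (Wmx x u T) (wvec (x T) (u T)).
Proof.
by rewrite /Wmx !datamx_add1 /wvec -[LHS]/(block_mx _ _ _ _) block_mxEh.
Qed.

(* Main.v *)
Require Import Defs.
From HB Require Import structures.
From mathcomp Require Import all_boot all_order all_algebra.
From mathcomp Require Import all_classical all_reals all_analysis.
Import Order.TTheory GRing.Theory Num.Theory.
Import numFieldNormedType.Exports.
Local Open Scope classical_set_scope.
Local Open Scope ring_scope.

(** A Gram matrix is the sum of the outer products of its columns, so one new sample [q] lowers
    [Nmx] by the rank-one term q q^T, while the larger disturbance bound raises its upper-left block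
    by [Omega]. [Nmx_row_mx] records this update. The congruence by [O] is linear and sends q q^T to
    h h^T with h = O q; scaling by -[alpha] then flips both signs, and the data-independent [F] is
    unchanged. *)

Lemma Nmx_row_mx (R : realType) (n p T : nat) (D D' : 'M[R]_n)
  (Y : 'M[R]_(n, T)) (W : 'M[R]_(p, T)) (y : 'cV[R]_n) (w : 'cV[R]_p) :
  Nmx D' (row_mx Y y) (row_mx W w)
  = Nmx D Y W + RNmx p (D' - D) - col_mx y (- w) *m (col_mx y (- w))^T.
Proof.
(* Reading the 2x2 block matrix by columns instead of rows exhibits the new sample as a single
   appended column. *)
have colE : col_mx (row_mx Y y) (- row_mx W w)
            = row_mx (col_mx Y (- W)) (col_mx y (- w)).
  by rewrite opp_row_mx -block_mxEv block_mxEh.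
rewrite /Nmx /RNmx colE tr_row_mx mul_row_col opprD addrA; congr (_ - _).
by rewrite addrAC add_block_mx !addr0 (addrC D) subrK.
Qed.

Theorem lemma1 (R : realType) (n m k : nat) (V : vectType R)
  (F : V -> R -> 'M[R]_k) (O : 'M[R]_(k, n + (n + m))) (K : set (V * R * R))
  (Uadm : set 'cV[R]_m)
  (A : 'M[R]_n) (B : 'M[R]_(n, m))
  (xs : nat -> 'cV[R]_n) (us : nat -> 'cV[R]_m) (es : nat -> 'cV[R]_n)
  (Delta : nat -> 'M[R]_n) (T : nat)
  (u : 'cV[R]_m) (y : 'cV[R]_n) :
  (forall theta rho, (F theta rho)^T = F theta rho) ->
  (forall rho, is_affine (fun theta : V => F theta rho)) ->
  (forall theta, is_affine (fun rho : R^o => F theta rho)) ->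
  compact Uadm ->
  controllable A B ->
  trajectory A B xs us es ->
  (forall t, (Delta t)^T = Delta t) ->
  (forall t, loewner_le (datamx es t *m (datamx es t)^T) (Delta t)) ->
  loewner_le (es T *m (es T)^T) (Omega Delta T) ->
  \rank (Wmx xs us T) = (n + m)%N ->
  Uadm u ->
  us T = u ->
  xs T.+1 = y ->
  forall (theta : V) (alpha rho : R),
    0 <= alpha ->
    K (theta, alpha, rho) ->
    Cmx F O (Delta T.+1) (row_mx (Ymx xs T) y)
        (row_mx (Wmx xs us T) (wvec (xs T) u)) theta alpha rho
    = Cmx F O (Delta T) (Ymx xs T) (Wmx xs us T) theta alpha rho
      + alpha *: (hvec O (xs T) u y *m (hvec O (xs T) u y)^T)
      - alpha *: Rmx O (Omega Delta T).
Proof.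
move=> _ _ _ _ _ _ _ _ _ _ _ _ _ theta alpha rho _ _.
(* The old bound does not occur in the matrix being rewritten; choosing [Delta T] makes the
   increment equal to [Omega Delta T]. *)
rewrite /Cmx (Nmx_row_mx _ _ _ _ (Delta T)) /Rmx /hvec /qvec /Omega.
rewrite mulmxBr mulmxDr mulmxBl mulmxDl trmx_mul !mulmxA.
by rewrite scalerBr scalerDr opprB opprD !addrA (addrAC (F _ _)).
Qed.
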